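(* Let $F$ be a binary sextic form with real coefficients and no real roots, and let $\alpha_1,\alpha_2,\alpha_3\in\mathbb H^2$ be its upper-half-plane roots (with multiplicity). Then $\xi_{\mathcal J}(F)=\xi_{\mathcal H}(F)$ if and only if one of the following holds: (i) $\alpha_1,\alpha_2,\alpha_3$ are not collinear (do not lie on a common hyperbolic geodesic) and form an equilateral hyperbolic triangle; or (ii) $\alpha_1,\alpha_2,\alpha_3$ are collinear (lie on a common hyperbolic geodesic) and one of them is the hyperbolic midpoint of the other two.
   Context: $\mathbb H^2=\{x+iy:y>0\}$ is the upper half-plane with hyperbolic distance $d_H$, $\cosh d_H(x+iy,u+iv)=1+\frac{(x-u)^2+(y-v)^2}{2yv}$. The hyperbolic midpoint of two equal points is that point. A real binary form of degree $2n$ with no real roots (in $\mathbb P^1(\mathbb R)$) factors as $F(X,Z)=a_0\prod_{i=1}^n (X-\alpha_iZ)(X-\overline{\alpha_i}Z)$ with $a_0\in\mathbb R\setminus\{0\}$; $\alpha_1,\ldots,\alpha_n\in\mathbb H^2$ are its upper-half-plane roots (with multiplicity). Julia's zero $\xi_{\mathcal J}(F)$: let $\mathbb H^3=\{z+t\mathbf{j}: z\in\mathbb C,\ t>0\}$, with $\mathbb H^2\subset\mathbb H^3$ via $x+iy\mapsto x+y\mathbf{j}$, and for $w=z+t\mathbf{j}$, $\alpha\in\mathbb C$ put $d_H(w,\alpha)=\ln\frac{|z-\alpha|^2+t^2}{t}$. A form of degree $N$ is stable if none of its roots has multiplicity at least $N/2$. For stable $F$ with all complex roots $\beta_1,\ldots,\beta_{2n}$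 (with multiplicity), $\xi_{\mathcal J}(F)$ is the unique point $w\in\mathbb H^3$ minimizing $\sum_{i=1}^{2n} d_H(w,\beta_i)$; for real $F$ with no real roots it lies in $\mathbb H^2$. If such an $F$ is not stable, then all $\alpha_i$ equal one point $\alpha$ and by convention $\xi_{\mathcal J}(F)=\alpha$. Hyperbolic zero $\xi_{\mathcal H}(F)$: it is the hyperbolic center of mass of $\alpha_1,\ldots,\alpha_n$, i.e. the unique point $Q\in\mathbb H^2$ minimizing $\sum_{i=1}^n\cosh d_H(Q,\alpha_i)$. *)

(* Defs.v *)
From HB Require Import structures.
From mathcomp Require Import all_boot all_order all_algebra.
From mathcomp Require Import all_classical reals sequences exp.
From mathcomp Require Import complex ring lra.
(* The notations of mpoly clash with those of MathComp-Analysis. *)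
From mathcomp Require Import -(notations) mpoly.

Set Implicit Arguments.
Unset Strict Implicit.
Unset Printing Implicit Defensive.

Import Order.TTheory GRing.Theory Num.Theory.
Local Open Scope classical_set_scope.
Local Open Scope ring_scope.
Local Open Scope complex_scope.

Section Hyperbolic.
Context {R : realType}.
Implicit Types x : R.

Definition cosh x : R := (expR x + expR (- x)) / 2.

(* inverse of the restriction of cosh to [0, +oo[; only meaningful for 1 <= x *)
Definition arcosh x : R := ln (x + Num.sqrt (x ^+ 2 - 1)).

(* [x0] is a junk value, used only if [f] has no minimizer. *)
Definition argmin (T : choiceType) (x0 : T) (f : T -> R) : T :=
  xget x0 [set w | forall w', f w <= f w'].

Definition H2 := {z : R[i] | 0 < complex.Im z}.

Definition re2 (p : H2) : R := complex.Re (val p).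
Definition im2 (p : H2) : R := complex.Im (val p).

Definition hdist (p q : H2) : R :=
  arcosh (1 + ((re2 p - re2 q) ^+ 2 + (im2 p - im2 q) ^+ 2)
              / (2 * im2 q * im2 p)).

(* The pair (z, t) stands for z + t j. *)
Definition H3 := {w : R[i] * R | 0 < w.2}.

Lemma H2_to_H3_subproof (p : H2) : 0 < ((re2 p)%:C, im2 p).2.
Proof. exact: (valP p). Qed.

Definition H2_to_H3 (p : H2) : H3 := exist _ ((re2 p)%:C, im2 p) (H2_to_H3_subproof p).

Lemma H2_i_subproof : 0 < complex.Im ('i : R[i]).
Proof. exact: ltr01. Qed.

Definition H2_i : H2 := exist _ 'i H2_i_subproof.

(* "distance" from an interior point of H3 to a boundary point b; this
   may be negative *)
Definition bdist (w : H3) (b : R[i]) : R :=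
  let: (z, t) := val w in ln ((ComplexField.Normc.normc (z - b) ^+ 2 + t ^+ 2) / t).

(* the geodesics of the upper half-plane model: vertical half-lines, and
   half-circles centered on the real axis *)
Definition is_geodesic (L : set H2) : Prop :=
  (exists c : R, L = [set p | re2 p = c]) \/
  (exists c r : R, 0 < r /\ L = [set p | (re2 p - c) ^+ 2 + im2 p ^+ 2 = r ^+ 2]).

Definition collinear (p q s : H2) : Prop :=
  exists L : set H2, is_geodesic L /\ [/\ L p, L q & L s].

Definition equilateral (p q s : H2) : Prop :=
  hdist p q = hdist q s /\ hdist q s = hdist s p.

(* For p = q this forces m = p. *)
Definition is_midpoint (m p q : H2) : Prop :=
  hdist p m = hdist p q / 2 /\ hdist m q = hdist p q / 2.

(* homogeneous polynomials of degree N in X = 'X_0 and Z = 'X_1 *)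
Definition binary_form (N : nat) := dhomog 2 R N.

Definition form_eval N (F : binary_form N) (x z : R) : R :=
  meval (tnth [tuple x; z]) (mpoly_of_dhomog F).

Definition no_real_root N (F : binary_form N) : Prop :=
  forall x z : R, (x, z) != (0, 0) -> form_eval F x z != 0.

Definition complexify N (F : binary_form N) : mpoly 2 R[i] :=
  map_mpoly (real_complex R) (mpoly_of_dhomog F).

(* X - b Z *)
Definition linear_factor (b : R[i]) : mpoly 2 R[i] :=
  mpolyX _ (mnm1 ord0) - b *: mpolyX _ (mnm1 ord_max).

Definition are_complex_roots N (F : binary_form N) (bs : seq R[i]) : Prop :=
  exists a0 : R, a0 != 0 /\
    complexify F = a0%:C *: \prod_(b <- bs) linear_factor b.

Definition are_upper_roots N (F : binary_form N) (alphas : seq H2) : Prop :=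
  exists a0 : R, a0 != 0 /\
    complexify F = a0%:C *:
      \prod_(a <- alphas) (linear_factor (val a) * linear_factor (val a)^*).

(* Both lists are determined by F up to order, and everything below is
   independent of the order chosen by [xget]. *)
Definition complex_roots N (F : binary_form N) : seq R[i] :=
  xget [::] [set bs | are_complex_roots F bs].

Definition upper_roots N (F : binary_form N) : seq H2 :=
  xget [::] [set alphas | are_upper_roots F alphas].

(* every multiplicity is < N / 2 *)
Definition stable N (F : binary_form N) : Prop :=
  forall b : R[i], (2 * count_mem b (complex_roots F) < N)%N.

(* Meant for forms without real roots: an unstable one has a single
   upper-half-plane root, which is then the head of [upper_roots F]. *)
Definition julia_zero N (F : binary_form N) : H3 :=
  if `[< stable F >] then
    argmin (H2_to_H3 H2_i) (fun w => \sum_(b <- complex_roots F) bdist w b)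
  else H2_to_H3 (head H2_i (upper_roots F)).

Definition hyperbolic_zero N (F : binary_form N) : H2 :=
  argmin H2_i (fun Q => \sum_(a <- upper_roots F) cosh (hdist Q a)).

Lemma arcoshK x : 1 <= x -> cosh (arcosh x) = x.
Proof.
move=> x1; rewrite /cosh /arcosh expRN.
set s := Num.sqrt _.
have s2 : s ^+ 2 = x ^+ 2 - 1.
  by rewrite sqr_sqrtr// subr_ge0 -[1](expr1n _ 2) lerXn2r// nnegrE; lra.
have y0 : 0 < x + s by rewrite ltr_wpDr ?sqrtr_ge0//; lra.
rewrite lnK ?posrE//.
have -> : (x + s)^-1 = x - s.
  by apply: (mulfI (lt0r_neq0 y0)); rewrite divff ?lt0r_neq0//; nra.
by field.
Qed.

Lemma arcosh_ge0 x : 1 <= x -> 0 <= arcosh x.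
Proof. by move=> x1; apply: ln_ge0; rewrite ler_wpDr ?sqrtr_ge0. Qed.

Lemma cosh_hdist (p q : H2) : cosh (hdist p q) =
  1 + ((re2 p - re2 q) ^+ 2 + (im2 p - im2 q) ^+ 2) / (2 * im2 q * im2 p).
Proof.
apply: arcoshK; rewrite lerDl divr_ge0 ?addr_ge0 ?sqr_ge0//.
by rewrite !mulr_ge0// ltW//; [exact: (valP q)|exact: (valP p)].
Qed.

End Hyperbolic.

Arguments H2 R : clear implicits.
Arguments H3 R : clear implicits.
Arguments binary_form R N : clear implicits.

(* Main.v *)
Require Import Defs.
From mathcomp Require Import all_boot all_order all_algebra.
From mathcomp Require Import all_classical reals sequences exp.
From mathcomp Require Import topology normedtype derive.
From mathcomp Require Import complex ring lra.
From mathcomp Require Import -(notations) mpoly.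

(** Work in the hyperboloid model, in Minkowski space [R^(1,2)], where the
    product of two points is the hyperbolic cosine of their distance.  Let
    [c_i] be this cosine for a point [Q] and the root [alpha_i].

    The hyperbolic zero minimizes [c_1 + c_2 + c_3].  This is the product of [Q]
    with the vector [alpha_1 + alpha_2 + alpha_3], so its only minimizer is the
    direction of that vector ([balanced], [cosh_sum_min]).

    Pairing each root with its conjugate, the sum defining the Julia zero is the
    logarithm of a product of three factors.  Each of them decreases under the
    orthogonal projection from [H3] to [H2] ([julia_factor_proj]), strictly off
    [H2] unless the root is the projected point.  On [H2] the factors are
    [(2 im2 alpha_i * c_i) ^+ 2].  So, in the stable case, the Julia zero
    minimizes [c_1 * c_2 * c_3] over [H2].  A minimizer exists by compactness
    ([cosh_prod_min_exists]); there the gradient vanishes, which says that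
    [alpha_1 / c_1 + alpha_2 / c_2 + alpha_3 / c_3] is proportional to [Q]
    ([klein_balanced], [min_klein_balanced]); and a point with this property is
    the only minimizer ([cosh_prod_min]).

    Hence the two zeros agree exactly if the point [Q] proportional to the sum
    of the [alpha_i] is also proportional to the sum of the [alpha_i / c_i].  If
    the roots are linearly independent, that is not collinear, the coefficients
    must be equal, so [c_1 = c_2 = c_3], which makes the triangle equilateral
    ([independent_equilateral]).  If the roots are collinear, then [Q] is on
    their geodesic; with signed distances [s_i] from [Q] the conditions are
    that the [sinh s_i] and the [tanh s_i] both have sum zero.  As [tanh] is a
    strictly subadditive function of [sinh] on positive numbers, some [s_i] is
    zero, and the other two are opposite ([dependent_midpoint]).  The converses
    are [equilateral_balanced] and [midpoint_balanced].  In the unstable case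
    the three roots are one point, which is both zeros and the midpoint of
    itself. *)

Set Implicit Arguments.
Unset Strict Implicit.
Unset Printing Implicit Defensive.

Import Order.TTheory GRing.Theory Num.Theory.
Import numFieldNormedType.Exports.
Local Open Scope classical_set_scope.
Local Open Scope ring_scope.
Local Open Scope complex_scope.

Section JuliaAndHyperbolicZeros.
Context {R : realType}.
Implicit Types (a p q s Q : H2 R) (w : H3 R) (x y : R).

(** * Uniqueness of the roots *)

(** Setting [Z := 1] turns [X - b Z] into ['X - b], so that the factorization
    of a form reduces to that of a univariate polynomial.  No root is lost, as
    none of the factors is [Z]. *)
Definition dehomogenize : mpoly 2 R[i] -> {poly R[i]} :=
  mmap (@polyC R[i]) (fun i : 'I_2 => if i == ord0 then 'X else 1).

Lemma dehomogenize_prod (c : R[i]) (bs : seq R[i]) :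
  dehomogenize (c *: \prod_(b <- bs) linear_factor b) =
  c *: \prod_(b <- bs) ('X - b%:P).
Proof.
rewrite /dehomogenize mmapZ mul_polyC; congr (_ *: _).
rewrite rmorph_prod /=; apply: eq_bigr => b _.
by rewrite /linear_factor mmapB mmapZ !mmapX !mmap1U /= mulr1.
Qed.

Lemma complex_roots_perm N (F : binary_form R N) (bs bs' : seq R[i]) :
  are_complex_roots F bs -> are_complex_roots F bs' -> perm_eq bs bs'.
Proof.
move=> [c [c0 Fc]] [c' [c'0 Fc']].
have : c%:C *: \prod_(b <- bs) ('X - b%:P) =
       c'%:C *: \prod_(b <- bs') ('X - b%:P).
  by rewrite -!dehomogenize_prod -Fc -Fc'.
move=> e; apply: prod_XsubC_eq.
have cc : c%:C = c'%:C :> R[i].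
  have := congr1 lead_coef e.
  by rewrite !lead_coefZ !(monicP (monic_prod_XsubC _ _ _)) !mulr1.
have cn : c'%:C != 0 :> R[i] by rewrite -(inj_eq (@complexI R)) in c'0.
by move: e; rewrite cc; apply: scalerI.
Qed.

Definition with_conjugates (s : seq (H2 R)) : seq R[i] :=
  flatten [seq [:: val a; (val a)^*] | a <- s].

Lemma with_conjugates_are_roots N (F : binary_form R N) (s : seq (H2 R)) :
  are_upper_roots F s -> are_complex_roots F (with_conjugates s).
Proof.
move=> [c [c0 Fc]]; exists c; split=> //; rewrite Fc; congr (_ *: _).
rewrite /with_conjugates big_flatten /= big_map; apply: eq_bigr => a _.
by rewrite !big_cons big_nil mulr1.
Qed.

(** The upper half-plane roots can be recovered from the complex ones, which
    transfers uniqueness from the latter to the former. *)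
Lemma filter_with_conjugates (s : seq (H2 R)) :
  [seq b <- with_conjugates s | 0 < complex.Im b] = map val s.
Proof.
elim: s => //= a s; rewrite /with_conjugates /= => ->.
have aP : 0 < complex.Im (sval a) by exact: (valP a).
have -> : complex.Im (sval a)^* = - complex.Im (sval a) by case: (sval a).
by rewrite aP oppr_gt0 ltNge (ltW aP).
Qed.

Lemma upper_roots_perm N (F : binary_form R N) (s s' : seq (H2 R)) :
  are_upper_roots F s -> are_upper_roots F s' -> perm_eq s s'.
Proof.
move=> /with_conjugates_are_roots r /with_conjugates_are_roots r'.
have inj : injective (val : H2 R -> R[i]) by move=> a b; apply: val_inj.
apply: (perm_map_inj inj).
rewrite -!filter_with_conjugates; apply: perm_filter.
exact: complex_roots_perm r r'.
Qed.

Lemma upper_rootsP N (F : binary_form R N) (s : seq (H2 R)) :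
  are_upper_roots F s -> perm_eq (upper_roots F) s.
Proof. by move=> r; apply: (upper_roots_perm _ r); exact: (xgetI _ r). Qed.

Lemma complex_rootsP N (F : binary_form R N) (s : seq (H2 R)) :
  are_upper_roots F s -> perm_eq (complex_roots F) (with_conjugates s).
Proof.
move=> /with_conjugates_are_roots r; apply: (complex_roots_perm _ r).
exact: (xgetI _ r).
Qed.

(** * Minkowski coordinates *)

Lemma im2_gt0 p : 0 < im2 p.
Proof. exact: (valP p). Qed.

Lemma H2_eq p q : re2 p = re2 q -> im2 p = im2 q -> p = q.
Proof.
rewrite /re2 /im2 => ex ey; apply: val_inj.
by move: ex ey; case: (val p) (val q) => [x y] [x' y'] /= -> ->.
Qed.

Definition H2_point x y (y0 : 0 < y) : H2 R := exist _ (x +i* y) y0.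

(** The hyperboloid model: [(mink0 Q a, mink1 Q a, mink2 Q a)] are the
    coordinates of [a] in Minkowski space [R^(1,2)], in an orthonormal frame
    whose timelike vector is [Q].  The value [mink0 Q a] is the hyperbolic
    cosine of the distance from [Q] to [a], and [Q] itself is [(1, 0, 0)]. *)
Definition mink0 Q a :=
  ((re2 a - re2 Q) ^+ 2 + im2 a ^+ 2 + im2 Q ^+ 2) / (2 * im2 Q * im2 a).
Definition mink1 Q a :=
  ((re2 a - re2 Q) ^+ 2 + im2 a ^+ 2 - im2 Q ^+ 2) / (2 * im2 Q * im2 a).
Definition mink2 Q a := (re2 a - re2 Q) / im2 a.

Lemma mink0_gt0 Q a : 0 < mink0 Q a.
Proof.
have := im2_gt0 Q; have := im2_gt0 a; rewrite /mink0 => a0 Q0.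
rewrite divr_gt0 ?mulr_gt0//; have := sqr_ge0 (re2 a - re2 Q); nra.
Qed.

Lemma mink0_sqr Q a : mink0 Q a ^+ 2 = 1 + mink1 Q a ^+ 2 + mink2 Q a ^+ 2.
Proof.
rewrite /mink0 /mink1 /mink2; field.
by rewrite !gt_eqF ?im2_gt0.
Qed.

Lemma mink0_ge1 Q a : 1 <= mink0 Q a.
Proof.
have := mink0_sqr Q a; have := mink0_gt0 Q a.
have := sqr_ge0 (mink1 Q a); have := sqr_ge0 (mink2 Q a); nra.
Qed.

(** The Minkowski product of [p] and [q] does not depend on the frame [Q]: for
    [Q = p] it is [mink0 p q]. *)
Lemma mink0E Q p q : mink0 p q =
  mink0 Q p * mink0 Q q - mink1 Q p * mink1 Q q - mink2 Q p * mink2 Q q.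
Proof.
rewrite /mink0 /mink1 /mink2; field.
by rewrite !gt_eqF ?im2_gt0.
Qed.

Lemma mink0C p q : mink0 p q = mink0 q p.
Proof. by rewrite /mink0; congr (_ / _); ring. Qed.

Lemma mink1_self Q : mink1 Q Q = 0.
Proof. by rewrite /mink1 subrr expr0n /= add0r subrr mul0r. Qed.

Lemma mink2_self Q : mink2 Q Q = 0.
Proof. by rewrite /mink2 subrr mul0r. Qed.

Lemma mink0_eq1 p q : mink0 p q = 1 -> p = q.
Proof.
move=> e; have p0 := im2_gt0 p; have q0 := im2_gt0 q.
have e2 : (re2 q - re2 p) ^+ 2 + (im2 q - im2 p) ^+ 2 = 0.
  have : mink0 p q * (2 * im2 p * im2 q) =
      (re2 q - re2 p) ^+ 2 + im2 q ^+ 2 + im2 p ^+ 2.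
    by rewrite /mink0 mulfVK// !mulf_neq0 ?pnatr_eq0// gt_eqF.
  rewrite e; nra.
move/eqP: e2; rewrite paddr_eq0 ?sqr_ge0// !sqrf_eq0 !subr_eq0.
by case/andP => /eqP e1 /eqP e2; apply: H2_eq.
Qed.

Lemma mink12_eq0 p q : mink1 p q = 0 -> mink2 p q = 0 -> p = q.
Proof.
move=> h k; apply: mink0_eq1; apply/eqP.
have := mink0_sqr p q; rewrite h k; have := mink0_gt0 p q => c0 c2.
by rewrite -subr_eq0; apply/eqP; nra.
Qed.

Lemma cosh_hdistE p q : cosh (hdist p q) = mink0 p q.
Proof.
rewrite cosh_hdist /mink0; field.
by rewrite !gt_eqF ?im2_gt0.
Qed.

Lemma hdistE p q : hdist p q = arcosh (mink0 p q).
Proof.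
rewrite /hdist /mink0; congr arcosh; field.
by rewrite !gt_eqF ?im2_gt0.
Qed.

Lemma cosh_double x : cosh (2 * x) = 2 * cosh x ^+ 2 - 1.
Proof.
have -> : 2 * x = x + x by ring.
rewrite /cosh opprD !expRD.
have : expR x * expR (- x) = 1 by rewrite -expRD subrr expR0.
move: (expR x) (expR (- x)) => u v e; nra.
Qed.

Lemma arcosh_double x : 1 <= x -> arcosh (2 * x ^+ 2 - 1) = 2 * arcosh x.
Proof.
move=> x1; rewrite /arcosh [RHS]mulr_natl -lnXn; last first.
  by rewrite ltr_wpDr ?sqrtr_ge0//; lra.
congr ln.
have s0 : 0 <= x ^+ 2 - 1 by nra.
have -> : (2 * x ^+ 2 - 1) ^+ 2 - 1 = (2 * x * Num.sqrt (x ^+ 2 - 1)) ^+ 2.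
  by rewrite exprMn sqr_sqrtr//; ring.
rewrite sqrtr_sqr ger0_norm; last by rewrite !mulr_ge0 ?sqrtr_ge0//; lra.
by rewrite sqrrD sqr_sqrtr//; ring.
Qed.

Lemma is_midpointE m p q : is_midpoint m p q <->
  mink0 p m = mink0 m q /\ mink0 p q = 2 * mink0 m q ^+ 2 - 1.
Proof.
rewrite /is_midpoint; split=> [[e1 e2]|[e1 e2]].
  split; first by rewrite -!cosh_hdistE e1 e2.
  by rewrite -!cosh_hdistE -cosh_double e2; congr cosh; field.
by rewrite !hdistE e1 e2 arcosh_double ?mink0_ge1//; split; field.
Qed.

Lemma equilateralE p q s : equilateral p q s <->
  mink0 p q = mink0 q s /\ mink0 q s = mink0 s p.
Proof.
rewrite /equilateral; split=> -[e1 e2]; last by rewrite !hdistE e1 e2.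
by rewrite -!cosh_hdistE e1 e2.
Qed.

(** Geodesics are the sections of the hyperboloid by planes through the origin,
    so collinearity is linear dependence of the three vectors. *)
Definition dependent Q p q s := exists A B D : R, (A, B, D) != 0 /\
  forall a, a \in [:: p; q; s] ->
    A * mink0 Q a + B * mink1 Q a + D * mink2 Q a = 0.

Lemma collinear_dependent Q p q s : collinear p q s -> dependent Q p q s.
Proof.
case=> L [gL [Lp Lq Ls]].
have {Lp Lq Ls} LA a : a \in [:: p; q; s] -> L a.
  by rewrite !inE => /or3P[] /eqP ->.
have y0 := im2_gt0 Q; have yn := lt0r_neq0 y0.
case: gL => [[c eL]|[c [r [r0 eL]]]]; rewrite {}eL /= in LA.
  exists (- ((c - re2 Q) / im2 Q)), ((c - re2 Q) / im2 Q), 1; split.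
    by apply/eqP => -[_ _ /eqP]; rewrite oner_eq0.
  move=> a /LA <-; rewrite /mink0 /mink1 /mink2; field.
  by rewrite !gt_eqF ?im2_gt0.
(* [mink0 + mink1] and [mink0 - mink1] are multiples of [|a - re2 Q|^2 / im2 a]
   and of [1 / im2 a]; the equation of the circle is divided by [im2 a] *)
pose G := ((re2 Q - c) ^+ 2 - r ^+ 2) / im2 Q.
exists (im2 Q + G), (im2 Q - G), (2 * (re2 Q - c)); split.
  apply/eqP => -[e1 e2 _]; move: y0.
  have : im2 Q + im2 Q = 0 by rewrite -[RHS]addr0 -{1}e1 -e2; ring.
  lra.
move=> a /LA e; rewrite /G -e /mink0 /mink1 /mink2; field.
by rewrite !gt_eqF ?im2_gt0.
Qed.

Lemma dependent_collinear Q p q s : dependent Q p q s -> collinear p q s.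
Proof.
case=> A [B [D [n0 rel]]].
have y0 := im2_gt0 Q; have yn := lt0r_neq0 y0.
have {}rel a : a \in [:: p; q; s] ->
    (A + B) * ((re2 a - re2 Q) ^+ 2 + im2 a ^+ 2) + (A - B) * im2 Q ^+ 2
      + 2 * D * im2 Q * (re2 a - re2 Q) = 0.
  move=> /rel e; transitivity (0 * (2 * im2 Q * im2 a)); last by rewrite mul0r.
  rewrite -e /mink0 /mink1 /mink2; field.
  by rewrite !gt_eqF ?im2_gt0.
have onL L : is_geodesic L -> (forall a, a \in [:: p; q; s] -> L a) ->
    collinear p q s.
  move=> gL La; exists L; split=> //.
  by split; apply: La; rewrite !inE eqxx ?orbT.
(* [A + B] is the coefficient of [x^2 + y^2]; it vanishes for vertical lines *)
have [E0|E0] := eqVneq (A + B) 0.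
  have BA : B = - A by apply/eqP; rewrite -addr_eq0 addrC E0.
  have Dn : D != 0.
    apply/eqP => D0; move: n0; rewrite BA D0.
    have := rel p; rewrite !inE eqxx => /(_ isT).
    rewrite E0 D0 BA opprK => e; have /eqP : (A + A) * im2 Q ^+ 2 = 0 by lra.
    rewrite mulf_eq0 expf_eq0 /= (negbTE yn) orbF => /eqP AA.
    have -> : A = 0 by lra.
    by rewrite oppr0 eqxx.
  apply: (onL [set a | re2 a = re2 Q - A * im2 Q / D]).
    by left; exists (re2 Q - A * im2 Q / D).
  move=> a /rel; rewrite E0 BA /= => e.
  have {}e : A * im2 Q + D * (re2 a - re2 Q) = 0.
    by apply: (mulfI yn); nra.
  by apply: (mulfI Dn); transitivity (D * re2 Q - A * im2 Q); [lra|field].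
set c := re2 Q - D * im2 Q / (A + B).
set rho := (D * im2 Q / (A + B)) ^+ 2 - (A - B) * im2 Q ^+ 2 / (A + B).
have circ a : a \in [:: p; q; s] -> (re2 a - c) ^+ 2 + im2 a ^+ 2 = rho.
  move=> /rel e; apply/eqP; rewrite -subr_eq0; apply/eqP.
  transitivity (0 / (A + B)); last by rewrite mul0r.
  by rewrite -e /rho /c; field.
have rho0 : 0 < rho.
  rewrite -(circ p) ?inE ?eqxx// ltr_wpDl ?sqr_ge0//.
  by rewrite exprn_gt0 ?im2_gt0.
apply: (onL [set a | (re2 a - c) ^+ 2 + im2 a ^+ 2 = Num.sqrt rho ^+ 2]).
  by right; exists c, (Num.sqrt rho); rewrite sqrtr_gt0.
by move=> a /circ /= ->; rewrite sqr_sqrtr// ltW.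
Qed.

(** * Balance points *)

(** [Q] is the direction of the vector [p + q + s] of Minkowski space. *)
Definition balanced Q p q s :=
  mink1 Q p + mink1 Q q + mink1 Q s = 0 /\
  mink2 Q p + mink2 Q q + mink2 Q s = 0.

(** Position of [a] in the Klein disc centered at [Q]. *)
Definition klein1 Q a := mink1 Q a / mink0 Q a.
Definition klein2 Q a := mink2 Q a / mink0 Q a.

(** [Q] is the Euclidean centroid of [p], [q], [s] in the Klein disc centered
    at [Q].  This says that [Q] is a critical point of [cosh_prod p q s]. *)
Definition klein_balanced Q p q s :=
  klein1 Q p + klein1 Q q + klein1 Q s = 0 /\
  klein2 Q p + klein2 Q q + klein2 Q s = 0.

Definition cosh_sum p q s Q := mink0 Q p + mink0 Q q + mink0 Q s.
Definition cosh_prod p q s Q := mink0 Q p * mink0 Q q * mink0 Q s.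

Lemma cosh_sum_gt0 p q s Q : 0 < cosh_sum p q s Q.
Proof. by rewrite !addr_gt0 ?mink0_gt0. Qed.

Lemma cosh_prod_gt0 p q s Q : 0 < cosh_prod p q s Q.
Proof. by apply: mulr_gt0; first apply: mulr_gt0; exact: mink0_gt0. Qed.

Lemma some_product_ge0 x y z : [|| 0 <= x * y, 0 <= y * z | 0 <= z * x].
Proof.
case: (lerP 0 (x * y)) => //= xy; case: (lerP 0 (y * z)) => //= yz; nra.
Qed.

Lemma balanced_rot Q p q s : balanced Q p q s -> balanced Q q s p.
Proof. by case=> e1 e2; split; rewrite addrC addrA. Qed.

Lemma klein_balanced_rot Q p q s :
  klein_balanced Q p q s -> klein_balanced Q q s p.
Proof. by case=> e1 e2; split; rewrite addrC addrA. Qed.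

(** The sum of distance cosines is a Minkowski product with [p + q + s], hence
    at [Q'] it is [mink0 Q Q' >= 1] times its value at the balance point [Q]. *)
Lemma cosh_sum_min Q p q s Q' : balanced Q p q s ->
  cosh_sum p q s Q <= cosh_sum p q s Q' /\
  (cosh_sum p q s Q' <= cosh_sum p q s Q -> Q' = Q).
Proof.
move=> [e1 e2]; have S0 := cosh_sum_gt0 p q s Q.
have -> : cosh_sum p q s Q' = mink0 Q Q' * cosh_sum p q s Q.
  rewrite {1}/cosh_sum !(mink0E Q Q').
  transitivity (mink0 Q Q' * cosh_sum p q s Q
    - mink1 Q Q' * (mink1 Q p + mink1 Q q + mink1 Q s)
    - mink2 Q Q' * (mink2 Q p + mink2 Q q + mink2 Q s)).
    by rewrite /cosh_sum; ring.
  by rewrite e1 e2; ring.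
split; first by rewrite ler_peMl ?mink0_ge1// ltW.
rewrite ger_pMl// => C1; symmetry; apply: mink0_eq1.
by apply/le_anti; rewrite C1 mink0_ge1.
Qed.

(** Two of the three numbers have the same sign.  If these are [u] and [v], the
    product is [C (C^2 - w^2) + u v (C - w)], where [C^2 - w^2 >= 1]. *)
Lemma prod3_ge (C u v w : R) : 0 < C -> u + v + w = 0 ->
  u ^+ 2 <= C ^+ 2 - 1 -> v ^+ 2 <= C ^+ 2 - 1 -> w ^+ 2 <= C ^+ 2 - 1 ->
  C <= (C - u) * (C - v) * (C - w).
Proof.
have main x y z : 0 <= x * y -> 0 < C -> x + y + z = 0 ->
    z ^+ 2 <= C ^+ 2 - 1 -> C <= (C - x) * (C - y) * (C - z).
  move=> xy C0 e z2; have ez : z = - (x + y) by lra.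
  have Cz : 0 <= C - z by nra.
  have -> : (C - x) * (C - y) * (C - z) =
      C * (C ^+ 2 - z ^+ 2) + x * y * (C - z).
    by rewrite ez; ring.
  have : 0 <= x * y * (C - z) by exact: mulr_ge0.
  have : 0 <= C * (C ^+ 2 - z ^+ 2 - 1) by apply: mulr_ge0; lra.
  nra.
move=> C0 e u2 v2 w2; case/or3P: (some_product_ge0 u v w) => h.
- exact: main.
- have -> : (C - u) * (C - v) * (C - w) = (C - v) * (C - w) * (C - u) by ring.
  by apply: main => //; lra.
- have -> : (C - u) * (C - v) * (C - w) = (C - w) * (C - u) * (C - v) by ring.
  by apply: main => //; lra.
Qed.

(** A critical point of the product of distance cosines is its only minimizer.
    Relative to its value at [Q], each factor at [Q'] is [C - t a], where
    [t a] is the scalar product of the Klein position of [a] with the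
    spacelike part of [Q'], and where [C = mink0 Q Q']; the [t a] add up to
    zero, and [prod3_ge] applies. *)
Lemma cosh_prod_min Q p q s Q' : klein_balanced Q p q s ->
  cosh_prod p q s Q <= cosh_prod p q s Q' /\
  (cosh_prod p q s Q' <= cosh_prod p q s Q -> Q' = Q).
Proof.
move=> [e1 e2].
have P0 := cosh_prod_gt0 p q s Q.
pose C := mink0 Q Q'.
pose t a := klein1 Q a * mink1 Q Q' + klein2 Q a * mink2 Q Q'.
have C0 : 0 < C := mink0_gt0 Q Q'.
have factor a : mink0 Q' a = mink0 Q a * (C - t a).
  rewrite (mink0E Q) /t /klein1 /klein2 /C; field.
  by rewrite gt_eqF ?mink0_gt0.
(* Cauchy-Schwarz; the Klein disc is the unit disc *)
have t2 a : t a ^+ 2 <= C ^+ 2 - 1.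
  have K1 : klein1 Q a ^+ 2 + klein2 Q a ^+ 2 <= 1.
    rewrite /klein1 /klein2; have := mink0_sqr Q a; have := mink0_gt0 Q a.
    move: (mink0 Q a) (mink1 Q a) (mink2 Q a) => c h k c0 c2.
    rewrite !exprMn -mulrDl exprVn ler_pdivrMr ?exprn_gt0//.
    by rewrite mul1r c2; lra.
  have -> : C ^+ 2 - 1 = mink1 Q Q' ^+ 2 + mink2 Q Q' ^+ 2.
    by rewrite /C mink0_sqr; ring.
  rewrite /t; move: K1.
  set k := klein1 Q a; set l := klein2 Q a.
  set x := mink1 Q Q'; set y := mink2 Q Q' => K1.
  have := sqr_ge0 (k * y - l * x).
  have : 0 <= (1 - (k ^+ 2 + l ^+ 2)) * (x ^+ 2 + y ^+ 2).
    by rewrite mulr_ge0 ?subr_ge0// addr_ge0 ?sqr_ge0.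
  nra.
have t_sum : t p + t q + t s = 0.
  transitivity ((klein1 Q p + klein1 Q q + klein1 Q s) * mink1 Q Q'
    + (klein2 Q p + klein2 Q q + klein2 Q s) * mink2 Q Q').
    by rewrite /t; ring.
  by rewrite e1 e2; ring.
have E : cosh_prod p q s Q' =
    (C - t p) * (C - t q) * (C - t s) * cosh_prod p q s Q.
  by rewrite /cosh_prod !factor; ring.
have ge := prod3_ge C0 t_sum (t2 p) (t2 q) (t2 s).
have C1 : 1 <= C := mink0_ge1 Q Q'.
rewrite E; split; first by rewrite ler_peMl ?(ltW P0)// (le_trans C1).
rewrite ger_pMl// => le1; symmetry; apply: mink0_eq1; apply/le_anti.
by rewrite C1 andbT (le_trans ge).
Qed.

(** The product of [p] with [p + q + s] is the same for all three vertices, as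
    the pairwise products are equal.  So the vertices are equidistant from the
    balance point, and the denominators of the Klein positions are equal. *)
Lemma equilateral_balanced Q p q s : balanced Q p q s -> equilateral p q s ->
  klein_balanced Q p q s.
Proof.
move=> [h0 k0] /equilateralE[e1 e2].
have S0 : cosh_sum p q s Q != 0 by rewrite gt_eqF ?cosh_sum_gt0.
have same a b c : mink1 Q a + mink1 Q b + mink1 Q c = 0 ->
    mink2 Q a + mink2 Q b + mink2 Q c = 0 ->
    mink0 Q a * (mink0 Q a + mink0 Q b + mink0 Q c) =
    1 + mink0 a b + mink0 a c.
  move=> h k; have := mink0_sqr Q a; rewrite !(mink0E Q a) => sq.
  have -> : 1 = mink0 Q a ^+ 2 - mink1 Q a ^+ 2 - mink2 Q a ^+ 2.
    by rewrite sq; ring.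
  apply/eqP; rewrite -subr_eq0; apply/eqP.
  transitivity (mink1 Q a * (mink1 Q a + mink1 Q b + mink1 Q c)
    + mink2 Q a * (mink2 Q a + mink2 Q b + mink2 Q c)); first by ring.
  by rewrite h k; ring.
have cp := same p q s h0 k0.
have cq : mink0 Q q * cosh_sum p q s Q = 1 + mink0 q s + mink0 q p.
  by rewrite -same; rewrite /cosh_sum; [congr (_ * _); ring| |]; lra.
have cs : mink0 Q s * cosh_sum p q s Q = 1 + mink0 s p + mink0 s q.
  by rewrite -same; rewrite /cosh_sum; [congr (_ * _); ring| |]; lra.
have epq : mink0 Q q = mink0 Q p.
  apply: (mulIf S0); rewrite cq cp (mink0C q p) (mink0C p s) e1 e2; ring.
have eps : mink0 Q s = mink0 Q p.
  apply: (mulIf S0); rewrite cs cp (mink0C s q) (mink0C p s) e1 e2; ring.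
rewrite /klein_balanced /klein1 /klein2 epq eps -!mulrDl h0 k0 mul0r.
by split.
Qed.

(** If [m] is the midpoint of [p] and [q] then [p + q] is proportional to [m],
    hence so is [m + p + q], and the balance point is [m]; the other two points
    are then opposite to each other. *)
Lemma midpoint_balanced Q m p q : balanced Q m p q -> is_midpoint m p q ->
  klein_balanced Q m p q.
Proof.
move=> [h0 k0] /is_midpointE[]; rewrite (mink0C p m).
set d := mink0 m q => mp pq; have d1 : 1 <= d := mink0_ge1 m q.
(* the vector [p + q - 2 d m] is null and orthogonal to [m], hence zero *)
pose v0 := mink0 Q p + mink0 Q q - 2 * d * mink0 Q m.
pose v1 := mink1 Q p + mink1 Q q - 2 * d * mink1 Q m.
pose v2 := mink2 Q p + mink2 Q q - 2 * d * mink2 Q m.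
have mq : d = mink0 m q by [].
rewrite !(mink0E Q m) in mp mq; rewrite (mink0E Q p) in pq.
have sm := mink0_sqr Q m; have sp := mink0_sqr Q p; have sq := mink0_sqr Q q.
have null : v0 ^+ 2 = v1 ^+ 2 + v2 ^+ 2.
  rewrite /v0 /v1 /v2; clearbody d; clear v0 v1 v2.
  move: mp pq mq sm sp sq {h0 k0 d1}.
  move: (mink0 Q m) (mink1 Q m) (mink2 Q m) => a0 a1 a2.
  move: (mink0 Q p) (mink1 Q p) (mink2 Q p) => b0 b1 b2.
  move: (mink0 Q q) (mink1 Q q) (mink2 Q q) => c0 c1 c2.
  move=> mp pq mq sm sp sq; apply/eqP; rewrite -subr_eq0; apply/eqP.
  transitivity ((b0 ^+ 2 - b1 ^+ 2 - b2 ^+ 2) + (c0 ^+ 2 - c1 ^+ 2 - c2 ^+ 2)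
    + 4 * d ^+ 2 * (a0 ^+ 2 - a1 ^+ 2 - a2 ^+ 2)
    + 2 * (b0 * c0 - b1 * c1 - b2 * c2)
    - 4 * d * (a0 * b0 - a1 * b1 - a2 * b2)
    - 4 * d * (a0 * c0 - a1 * c1 - a2 * c2)); first by ring.
  by rewrite pq mp -mq sm sp sq; ring.
have orth : mink0 Q m * v0 = mink1 Q m * v1 + mink2 Q m * v2.
  apply/eqP; rewrite -subr_eq0; apply/eqP.
  transitivity
    ((mink0 Q m * mink0 Q p - mink1 Q m * mink1 Q p - mink2 Q m * mink2 Q p)
    + (mink0 Q m * mink0 Q q - mink1 Q m * mink1 Q q - mink2 Q m * mink2 Q q)
    - 2 * d * (mink0 Q m ^+ 2 - mink1 Q m ^+ 2 - mink2 Q m ^+ 2)).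
    by rewrite /v0 /v1 /v2; ring.
  by rewrite mp -mq sm; ring.
have v00 : v0 ^+ 2 <= 0.
  have : mink0 Q m ^+ 2 * v0 ^+ 2 <= (mink0 Q m ^+ 2 - 1) * v0 ^+ 2.
    rewrite -exprMn orth null sm.
    have := sqr_ge0 (mink1 Q m * v2 - mink2 Q m * v1); nra.
  by lra.
have v12 : v1 ^+ 2 + v2 ^+ 2 = 0.
  by rewrite -null; apply/le_anti; rewrite v00 sqr_ge0.
move/eqP: (v12); rewrite paddr_eq0 ?sqr_ge0// !sqrf_eq0.
move=> /andP[/eqP v1z /eqP v2z].
have d21 : 2 * d + 1 != 0 by rewrite gt_eqF//; lra.
have hm : mink1 Q m = 0.
  apply: (mulfI d21); rewrite mulr0 -[RHS]h0; rewrite /v1 in v1z; lra.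
have km : mink2 Q m = 0.
  apply: (mulfI d21); rewrite mulr0 -[RHS]k0; rewrite /v2 in v2z; lra.
have hpq : mink1 Q q = - mink1 Q p by lra.
have kpq : mink2 Q q = - mink2 Q p by lra.
have cpq : mink0 Q q = mink0 Q p.
  apply: (pexpIrn (n := 2)); rewrite ?nnegrE ?(ltW (mink0_gt0 _ _))//.
  by rewrite !mink0_sqr hpq kpq !sqrrN.
rewrite /klein_balanced /klein1 /klein2 hm km hpq kpq cpq.
by split; ring.
Qed.

Lemma longer_denominator (m x y c e : R) : 0 < m -> 0 < c -> 0 < e ->
  c ^+ 2 = 1 + m * x ^+ 2 -> e ^+ 2 = 1 + m * (x + y) ^+ 2 -> 0 < x * y ->
  c < e.
Proof.
move=> m0 c0 e0 c2 e2 xy; rewrite -(ltr_pXn2r (n := 2)) ?nnegrE ?ltW//.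
rewrite c2 e2 ltrD2l ltr_pM2l// sqrrD -addrA ltrDl.
by have := sqr_ge0 y; rewrite mulr2n; lra.
Qed.

(** This is the strict subadditivity of [t / sqrt (1 + m t^2)] on [t >= 0]: if
    [x] and [y] are nonzero of the same sign, then [x / c + y / d] is larger in
    absolute value than [(x + y) / e = - z / e]. *)
Lemma sum0_prod0_same_sign (m x y z c d e : R) : 0 <= x * y ->
  0 < m -> 0 < c -> 0 < d -> 0 < e -> c ^+ 2 = 1 + m * x ^+ 2 ->
  d ^+ 2 = 1 + m * y ^+ 2 -> e ^+ 2 = 1 + m * z ^+ 2 ->
  x + y + z = 0 -> x / c + y / d + z / e = 0 -> x * y * z = 0.
Proof.
move=> xy m0 c0 d0 e0 c2 d2 e2 s0 t0.
have ez : z = - (x + y) by lra.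
rewrite ez sqrrN in e2.
have [/eqP xy0|xyn] := boolP (x * y == 0); first by rewrite xy0 mul0r.
have xy0 : 0 < x * y by rewrite lt_def xyn.
have ce := longer_denominator m0 c0 e0 c2 e2 xy0.
have de : d < e.
  by apply: (@longer_denominator m y x) => //; rewrite ?(addrC y)// mulrC.
have pos f : 0 < f -> f < e -> 0 < f^-1 - e^-1.
  by move=> f0 fe; rewrite subr_gt0 ltf_pV2.
have {}t0 : x * (c^-1 - e^-1) + y * (d^-1 - e^-1) = 0 by rewrite -t0 ez; ring.
have := pos _ c0 ce; have := pos _ d0 de.
move: t0; set f := _ - e^-1; set g := _ - e^-1 => t0 g0 f0.
have : x * (x * f + y * g) = 0 by rewrite t0 mulr0.
have : 0 < x * y * g by exact: mulr_gt0.
have : 0 <= x ^+ 2 * f by rewrite mulr_ge0 ?sqr_ge0// ltW.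
lra.
Qed.

Lemma sum0_prod0 (m x y z c d e : R) : 0 < m -> 0 < c -> 0 < d -> 0 < e ->
  c ^+ 2 = 1 + m * x ^+ 2 -> d ^+ 2 = 1 + m * y ^+ 2 ->
  e ^+ 2 = 1 + m * z ^+ 2 ->
  x + y + z = 0 -> x / c + y / d + z / e = 0 -> x * y * z = 0.
Proof.
move=> m0 c0 d0 e0 c2 d2 e2 s0 t0; case/or3P: (some_product_ge0 x y z) => xy.
- exact: (@sum0_prod0_same_sign m x y z c d e).
- have -> : x * y * z = y * z * x by ring.
  by apply: (@sum0_prod0_same_sign m y z x d e c) => //; lra.
- have -> : x * y * z = z * x * y by ring.
  by apply: (@sum0_prod0_same_sign m z x y e c d) => //; lra.
Qed.

Lemma center_midpoint p q s : balanced p p q s -> is_midpoint p q s.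
Proof.
rewrite /balanced mink1_self mink2_self !add0r => -[h k].
have hs : mink1 p s = - mink1 p q by lra.
have ks : mink2 p s = - mink2 p q by lra.
have cs : mink0 p s = mink0 p q.
  apply: (pexpIrn (n := 2)); rewrite ?nnegrE ?(ltW (mink0_gt0 _ _))//.
  by rewrite !mink0_sqr hs ks !sqrrN.
apply/is_midpointE; rewrite (mink0C q p) cs; split=> //.
by rewrite (mink0E p) cs hs ks mink0_sqr; have := mink0_sqr p q; nra.
Qed.

(** The sum of the three relations is [A (c_p + c_q + c_s) = 0], so the common
    geodesic passes through [Q].  On it, [x] is proportional to the hyperbolic
    sine of the signed distance from [Q], and [sum0_prod0] shows that one of the
    three points is [Q]. *)
Lemma dependent_midpoint Q p q s : balanced Q p q s -> klein_balanced Q p q s ->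
  dependent Q p q s ->
  is_midpoint p q s \/ is_midpoint q p s \/ is_midpoint s p q.
Proof.
move=> bal [e1 e2] [A [B [D [n0 rel]]]]; case: (bal) => h0 k0.
have A0 : A = 0.
  have S0 : cosh_sum p q s Q != 0 by rewrite gt_eqF ?cosh_sum_gt0.
  apply: (mulIf S0); rewrite mul0r.
  have := rel p; have := rel q; have := rel s; rewrite !inE !eqxx !orbT /=.
  move=> /(_ isT) rs /(_ isT) rq /(_ isT) rp.
  transitivity (A * cosh_sum p q s Q
     + B * (mink1 Q p + mink1 Q q + mink1 Q s)
     + D * (mink2 Q p + mink2 Q q + mink2 Q s)).
    by rewrite h0 k0; ring.
  by rewrite /cosh_sum; lra.
pose m := B ^+ 2 + D ^+ 2.
have m0 : 0 < m.
  rewrite lt_def addr_ge0 ?sqr_ge0// andbT paddr_eq0 ?sqr_ge0// !sqrf_eq0.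
  by apply: contra n0 => /andP[/eqP -> /eqP ->]; rewrite A0.
have mn := lt0r_neq0 m0.
pose x a := (B * mink2 Q a - D * mink1 Q a) / m.
have hx a : a \in [:: p; q; s] -> mink1 Q a = - D * x a /\ mink2 Q a = B * x a.
  move=> /rel; rewrite A0 mul0r add0r => r.
  split; apply: (mulIf mn); rewrite /x -[in RHS]mulrA mulfVK//.
    transitivity (mink1 Q a * m - B * (B * mink1 Q a + D * mink2 Q a)).
      by rewrite r; ring.
    by rewrite /m; ring.
  transitivity (mink2 Q a * m - D * (B * mink1 Q a + D * mink2 Q a)).
    by rewrite r; ring.
  by rewrite /m; ring.
have cx a : a \in [:: p; q; s] -> mink0 Q a ^+ 2 = 1 + m * x a ^+ 2.
  by move=> /hx[h k]; rewrite mink0_sqr h k /m; ring.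
have pin : p \in [:: p; q; s] by rewrite !inE eqxx.
have qin : q \in [:: p; q; s] by rewrite !inE eqxx orbT.
have sin : s \in [:: p; q; s] by rewrite !inE eqxx !orbT.
have xyz : x p * x q * x s = 0.
  apply: (sum0_prod0 m0 (mink0_gt0 Q p) (mink0_gt0 Q q) (mink0_gt0 Q s)
    (cx p pin) (cx q qin) (cx s sin)).
    transitivity ((B * (mink2 Q p + mink2 Q q + mink2 Q s)
      - D * (mink1 Q p + mink1 Q q + mink1 Q s)) / m).
      by rewrite /x; ring.
    by rewrite h0 k0; ring.
  transitivity ((B * (klein2 Q p + klein2 Q q + klein2 Q s)
      - D * (klein1 Q p + klein1 Q q + klein1 Q s)) / m).
    by rewrite /x /klein1 /klein2; ring.
  by rewrite e1 e2; ring.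
have at_Q a : a \in [:: p; q; s] -> x a = 0 -> Q = a.
  by move=> /hx[h k] x0; apply: mink12_eq0; rewrite ?h ?k x0 mulr0.
clearbody x; move/eqP: xyz; rewrite !mulf_eq0 -orbA => /or3P[] /eqP x0.
- left; apply: center_midpoint; move: bal.
  by rewrite (at_Q p pin x0).
- right; left; have := balanced_rot bal; rewrite (at_Q q qin x0) => b.
  apply: center_midpoint; case: b => b1 b2; split; lra.
- do 2 right; apply: center_midpoint.
  by have := balanced_rot (balanced_rot bal); rewrite (at_Q s sin x0).
Qed.

(** Both weight vectors [(1, 1, 1)] and [(1 / c_p, 1 / c_q, 1 / c_s)] annihilate
    the spacelike coordinates, which have rank 2.  So the weights are
    proportional, and the points are equidistant from [Q]. *)
Lemma independent_equilateral Q p q s :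
  balanced Q p q s -> klein_balanced Q p q s ->
  ~ dependent Q p q s -> equilateral p q s.
Proof.
move=> [h0 k0] [e1 e2] nd.
have hs : mink1 Q s = - (mink1 Q p + mink1 Q q) by lra.
have ks : mink2 Q s = - (mink2 Q p + mink2 Q q) by lra.
have det0 : mink1 Q p * mink2 Q q - mink1 Q q * mink2 Q p != 0.
  apply/eqP => det0; apply: nd.
  have dep B D : (B, D) != 0 -> B * mink1 Q p + D * mink2 Q p = 0 ->
      B * mink1 Q q + D * mink2 Q q = 0 -> dependent Q p q s.
    move=> n0 rp rq; exists 0, B, D; split.
      by apply: contra n0 => /eqP -[-> ->].
    move=> a; rewrite !inE => /or3P[] /eqP ->; rewrite mul0r add0r//.
    by rewrite hs ks; lra.
  have [z|n] := eqVneq (mink1 Q p, mink2 Q p) 0.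
    case: z => z1 z2.
    have [z'|n'] := eqVneq (mink1 Q q, mink2 Q q) 0.
      case: z' => z1' z2'; apply: (dep 1 0); rewrite ?z1 ?z2 ?z1' ?z2'; try lra.
      by apply/eqP => -[/eqP]; rewrite oner_eq0.
    apply: (dep (- mink2 Q q) (mink1 Q q)); rewrite ?z1 ?z2; try ring.
    by apply: contra n' => /eqP -[/eqP]; rewrite oppr_eq0 => /eqP -> ->.
  apply: (dep (- mink2 Q p) (mink1 Q p)); [|ring|lra].
  by apply: contra n => /eqP -[/eqP]; rewrite oppr_eq0 => /eqP -> ->.
pose f := (mink0 Q p)^-1 - (mink0 Q s)^-1.
pose g := (mink0 Q q)^-1 - (mink0 Q s)^-1.
have r1 : mink1 Q p * f + mink1 Q q * g = 0.
  by rewrite -e1 /f /g /klein1 hs; ring.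
have r2 : mink2 Q p * f + mink2 Q q * g = 0.
  by rewrite -e2 /f /g /klein2 ks; ring.
have f0 : f = 0.
  apply: (mulIf det0); rewrite mul0r.
  transitivity (mink2 Q q * (mink1 Q p * f + mink1 Q q * g)
    - mink1 Q q * (mink2 Q p * f + mink2 Q q * g)); first by ring.
  by rewrite r1 r2; ring.
have g0 : g = 0.
  apply: (mulIf det0); rewrite mul0r.
  transitivity (mink1 Q p * (mink2 Q p * f + mink2 Q q * g)
    - mink2 Q p * (mink1 Q p * f + mink1 Q q * g)); first by ring.
  by rewrite r1 r2; ring.
have cp : mink0 Q p = mink0 Q s by apply: invr_inj; rewrite /f in f0; lra.
have cq : mink0 Q q = mink0 Q s by apply: invr_inj; rewrite /g in g0; lra.
have sp := mink0_sqr Q p; have sq := mink0_sqr Q q; have ss := mink0_sqr Q s.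
apply/equilateralE; rewrite (mink0E Q p) (mink0E Q q) (mink0E Q s) cp cq.
rewrite cp in sp; rewrite cq in sq; rewrite hs ks in ss *.
split; nra.
Qed.

(** * Existence of balance points *)

(** The two equations say that [x] is the mean of the [re2 a] with weights
    [1 / im2 a], and then that [y ^+ 2] is the mean [Y], with the same weights,
    of the [(re2 a - x) ^+ 2 + im2 a ^+ 2]. *)
Lemma balanced_exists p q s : exists Q, balanced Q p q s.
Proof.
have p0 := im2_gt0 p; have q0 := im2_gt0 q; have s0 := im2_gt0 s.
pose W := (im2 p)^-1 + (im2 q)^-1 + (im2 s)^-1.
have W0 : 0 < W by rewrite !addr_gt0 ?invr_gt0.
pose x := (re2 p / im2 p + re2 q / im2 q + re2 s / im2 s) / W.
pose t a := ((re2 a - x) ^+ 2 + im2 a ^+ 2) / im2 a.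
have t0 a : 0 < t a.
  by rewrite divr_gt0 ?im2_gt0// ltr_wpDl ?sqr_ge0// exprn_gt0 ?im2_gt0.
pose Y := (t p + t q + t s) / W.
have Y0 : 0 < Y by rewrite divr_gt0// !addr_gt0.
have y0 : 0 < Num.sqrt Y by rewrite sqrtr_gt0.
have y2 : Num.sqrt Y ^+ 2 = Y by rewrite sqr_sqrtr// ltW.
have Wn := lt0r_neq0 W0.
exists (H2_point x y0); split.
  transitivity ((t p + t q + t s - W * Num.sqrt Y ^+ 2) / (2 * Num.sqrt Y)).
    rewrite /mink1 /re2 /im2 /= -!/(im2 _) -!/(re2 _) /t /W; field.
    by rewrite !gt_eqF.
  by rewrite y2 /Y [W * _]mulrC divfK// subrr mul0r.
transitivity (re2 p / im2 p + re2 q / im2 q + re2 s / im2 s - W * x).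
  by rewrite /mink2 /re2 /im2 /= -!/(im2 _) -!/(re2 _) /W; ring.
by rewrite /x [W * _]mulrC divfK// subrr.
Qed.

Lemma poly_min_deriv (P : {poly R}) (lo hi c : R) : lo < c < hi ->
  (forall x, lo < x < hi -> P.[c] <= P.[x]) -> P^`().[c] = 0.
Proof.
move=> /andP[lc ch] mn.
have [_ <-] : is_derive c (1 : R) (horner P) P^`().[c] := is_derive_poly P c.
have : is_derive c (1 : R) (horner P) 0.
  apply: (@derive1_at_min _ _ lo hi).
  - by rewrite ltW// (lt_trans lc).
  - by move=> t _; apply: derivable_horner.
  - by rewrite in_itv /= lc ch.
  - by move=> t; rewrite in_itv /=; apply: mn.
by case.
Qed.

(** Up to a constant, [cosh_prod] is the product of the [N x y a] divided by
    [y ^+ 3].  So two polynomials attain their minima at [Q]: in [x], this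
    product; in [y], its difference with [m *: 'X ^+ 3], where [m] is the least
    value of the quotient.  Their derivatives yield the two equations. *)
Lemma min_klein_balanced Q p q s :
  (forall Q', cosh_prod p q s Q <= cosh_prod p q s Q') ->
  klein_balanced Q p q s.
Proof.
move=> mn; have y0 := im2_gt0 Q; have yn := lt0r_neq0 y0.
have p0 := im2_gt0 p; have q0 := im2_gt0 q; have s0 := im2_gt0 s.
pose N x y a := (re2 a - x) ^+ 2 + im2 a ^+ 2 + y ^+ 2.
have N0 a : N (re2 Q) (im2 Q) a != 0.
  rewrite gt_eqF// ltr_wpDl ?exprn_gt0//.
  by rewrite addr_ge0 ?sqr_ge0.
pose K := 8 * im2 p * im2 q * im2 s.
have K0 : 0 < K by rewrite !mulr_gt0.
have PN x y (h : 0 < y) :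
    N x y p * N x y q * N x y s = K * y ^+ 3 * cosh_prod p q s (H2_point x h).
  rewrite /cosh_prod /mink0 /re2 /im2 /= -!/(im2 _) -!/(re2 _) /K /N; field.
  by rewrite !gt_eqF.
have [m mE] : {m | m = K * cosh_prod p q s Q} by exists (K * cosh_prod p q s Q).
have m_min Q' : m <= K * cosh_prod p q s Q' by rewrite mE ler_pM2l.
have PNQ : N (re2 Q) (im2 Q) p * N (re2 Q) (im2 Q) q * N (re2 Q) (im2 Q) s
    = m * im2 Q ^+ 3.
  rewrite mE [RHS]mulrAC.
  have -> : cosh_prod p q s Q = cosh_prod p q s (H2_point (re2 Q) y0).
    by congr cosh_prod; apply: H2_eq.
  exact: PN.
split.
  pose G a : {poly R} := ((re2 a - re2 Q) ^+ 2 + im2 a ^+ 2)%:P + 'X ^+ 2.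
  have Gy y a : (G a).[y] = N (re2 Q) y a by rewrite /G /N !hornerE.
  have GD a : (G a)^`().[im2 Q] = 2 * im2 Q.
    by rewrite /G derivD derivC derivXn !hornerE /=; ring.
  clearbody G.
  pose P : {poly R} := G p * G q * G s - m *: 'X ^+ 3.
  have PE y : P.[y] = N (re2 Q) y p * N (re2 Q) y q * N (re2 Q) y s -
      m * y ^+ 3 by rewrite /P !hornerE !Gy.
  have : P^`().[im2 Q] = 0.
    apply: (@poly_min_deriv _ 0 (2 * im2 Q)); first by rewrite y0; lra.
    move=> y /andP[h _]; rewrite !PE PNQ (PN _ _ h).
    by rewrite subrr subr_ge0 mulrAC ler_pM2r ?exprn_gt0.
  rewrite /P derivB derivZ derivXn !derivM !hornerE !GD !Gy /=.
  move=> e; have k1 a : klein1 Q a = 1 - 2 * im2 Q ^+ 2 / N (re2 Q) (im2 Q) a.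
    have := N0 a; rewrite /klein1 /mink1 /mink0 /N => n0; field.
    by rewrite n0 yn gt_eqF ?im2_gt0.
  rewrite !k1; have := N0 p; have := N0 q; have := N0 s; move: e PNQ.
  move: (N _ _ p) (N _ _ q) (N _ _ s) => n1 n2 n3 e n123 n3n n2n n1n.
  transitivity (0 * (- im2 Q / (n1 * n2 * n3))); last by rewrite mul0r.
  (* [m * im2 Q ^+ 3] is to be replaced by [n1 * n2 * n3] *)
  have m3 : m = n1 * n2 * n3 / im2 Q ^+ 3 by rewrite n123 mulfK ?expf_neq0.
  by rewrite -[in RHS]e m3; field; rewrite n1n n2n n3n yn.
pose G a : {poly R} := ((re2 a)%:P - 'X) ^+ 2 + (im2 a ^+ 2 + im2 Q ^+ 2)%:P.
have Gx x a : (G a).[x] = N x (im2 Q) a by rewrite /G /N !hornerE.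
have GD a : (G a)^`().[re2 Q] = - 2 * (re2 a - re2 Q).
  by rewrite /G derivD derivC expr2 derivM derivB derivC derivX !hornerE; ring.
clearbody G; pose P : {poly R} := G p * G q * G s.
have PE x : P.[x] = N x (im2 Q) p * N x (im2 Q) q * N x (im2 Q) s.
  by rewrite /P !hornerE !Gx.
have : P^`().[re2 Q] = 0.
  apply: (@poly_min_deriv _ (re2 Q - 1) (re2 Q + 1)); first by apply/andP; lra.
  move=> x _; rewrite !PE PNQ (PN _ _ y0).
  by rewrite mulrAC ler_pM2r ?exprn_gt0.
rewrite /P !derivM !hornerE !GD !Gx => e.
have k2 a : klein2 Q a = 2 * im2 Q * (re2 a - re2 Q) / N (re2 Q) (im2 Q) a.
  have := N0 a; rewrite /klein2 /mink2 /mink0 /N => n0; field.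
  by rewrite n0 yn gt_eqF ?im2_gt0.
rewrite !k2.
have := N0 p; have := N0 q; have := N0 s; move: e.
move: (N _ _ p) (N _ _ q) (N _ _ s) => n1 n2 n3 e n3n n2n n1n.
transitivity (0 * (- im2 Q / (n1 * n2 * n3))); last by rewrite mul0r.
by rewrite -[in RHS]e; field; rewrite n1n n2n n3n.
Qed.

(** As each factor is at least 1, a bound [M] on the product bounds the
    distance to [p], which confines the point to a compact box. *)
Lemma cosh_prod_min_exists p q s :
  exists Q, forall Q', cosh_prod p q s Q <= cosh_prod p q s Q'.
Proof.
have p0 := im2_gt0 p.
pose M := cosh_prod p q s p.
have bound Q : mink0 Q p <= cosh_prod p q s Q.
  rewrite /cosh_prod -mulrA ler_peMr ?(ltW (mink0_gt0 _ _))//.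
  by rewrite -[1](mulr1 1) ler_pM ?mink0_ge1.
have M1 : 1 <= M by apply: le_trans (bound p); apply: mink0_ge1.
pose b := 2 * im2 p * M; pose l := im2 p / (2 * M).
have l0 : 0 < l by rewrite divr_gt0//; lra.
pose box : set (R * R) :=
  [set` `[re2 p - b, re2 p + b]%R] `*` [set` `[l, b]%R].
have box_of Q : mink0 Q p <= M -> box (re2 Q, im2 Q).
  move=> le; have y0 := im2_gt0 Q.
  have {}le : (re2 p - re2 Q) ^+ 2 + im2 p ^+ 2 + im2 Q ^+ 2 <= b * im2 Q.
    have -> : b * im2 Q = M * (2 * im2 Q * im2 p) by rewrite /b; ring.
    by rewrite -ler_pdivrMr// !mulr_gt0.
  have yb : im2 Q <= b.
    rewrite -(ler_pM2r y0) -expr2; apply: le_trans le.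
    by rewrite lerDr addr_ge0 ?sqr_ge0.
  have ly : l <= im2 Q.
    rewrite /l ler_pdivrMr; last lra.
    rewrite -(ler_pM2l p0); have := sqr_ge0 (re2 p - re2 Q).
    by rewrite /b in le; nra.
  have xb : (re2 p - re2 Q) ^+ 2 <= b ^+ 2 by nra.
  have b0 : 0 <= b by apply: mulr_ge0; lra.
  have {}xb : - b <= re2 p - re2 Q <= b.
    by rewrite -ler_norml -(ler_pXn2r (n := 2)) ?nnegrE// real_normK ?num_real.
  split => /=; rewrite in_itv /=; first by apply/andP; lra.
  by rewrite ly.
pose N a (u : R * R) :=
  ((re2 a - u.1) ^+ 2 + im2 a ^+ 2 + u.2 ^+ 2) / (2 * u.2 * im2 a).
have PN Q : cosh_prod p q s Q =
    N p (re2 Q, im2 Q) * N q (re2 Q, im2 Q) * N s (re2 Q, im2 Q) by [].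
have cN a u : 0 < u.2 -> {for u, continuous (N a)}.
  have cx : (fun v : R * R => re2 a - v.1) @ u --> re2 a - u.1.
    exact: cvgB (cvg_cst _) cvg_fst.
  move=> u0; apply: cvgM.
    apply: cvgD; last exact: cvgM cvg_snd cvg_snd.
    by apply: cvgD; [exact: (cvgM cx cx)|exact: cvg_cst].
  apply: cvgV; first by rewrite gt_eqF// !mulr_gt0 ?im2_gt0.
  by apply: cvgM; [apply: cvgM; [exact: cvg_cst|exact: cvg_snd]|exact: cvg_cst].
have box_p : box (re2 p, im2 p) by apply: box_of; apply: bound.
have [u ubox umin] : exists2 u, u \in box & forall v, v \in box ->
    N p u * N q u * N s u <= N p v * N q v * N s v.
  apply: compact_EVT_min.
  - by exists (re2 p, im2 p).
  - by apply: compact_setX; apply: segment_compact.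
  apply: continuous_in_subspaceT => v; rewrite inE => -[_ /=].
  rewrite in_itv /= => /andP[lv _].
  have v0 : 0 < v.2 by apply: lt_le_trans lv.
  by apply: cvgM; [apply: cvgM|]; apply: cN.
have u0 : 0 < u.2.
  move: ubox; rewrite inE => -[_ /=]; rewrite in_itv /= => /andP[lv _].
  exact: lt_le_trans lv.
exists (H2_point u.1 u0) => Q'.
have -> : cosh_prod p q s (H2_point u.1 u0) = N p u * N q u * N s u by [].
have [le|lt] := leP (mink0 Q' p) M.
  by rewrite PN; apply: umin; rewrite inE; apply: box_of.
apply: le_trans (ltW (lt_le_trans lt (bound Q'))).
by rewrite /M PN; apply: umin; rewrite inE.
Qed.

(** * The two zeros of a form *)

Definition re3 w : R := complex.Re (val w).1.
Definition im3 w : R := complex.Im (val w).1.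
Definition height w : R := (val w).2.

Lemma height_gt0 w : 0 < height w.
Proof. exact: (valP w). Qed.

Lemma H3_eq w w' : re3 w = re3 w' -> im3 w = im3 w' -> height w = height w' ->
  w = w'.
Proof.
rewrite /re3 /im3 /height => ex ey et; apply: val_inj.
by move: ex ey et; case: (val w) (val w') => [[x y] t] [[x' y'] t'] /= -> -> ->.
Qed.

Lemma H2_to_H3_inj : injective (@H2_to_H3 R).
Proof.
move=> p q e; apply: H2_eq.
  exact: (congr1 re3 e).
exact: (congr1 height e).
Qed.

(** The exponential of the contribution of a root and its conjugate. *)
Definition julia_factor w a : R :=
  ((re3 w - re2 a) ^+ 2 + (im3 w - im2 a) ^+ 2 + height w ^+ 2) *
  ((re3 w - re2 a) ^+ 2 + (im3 w + im2 a) ^+ 2 + height w ^+ 2) / height w ^+ 2.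

Definition julia_prod p q s w : R :=
  julia_factor w p * julia_factor w q * julia_factor w s.

Lemma julia_factor_gt0 w a : 0 < julia_factor w a.
Proof.
have t0 := height_gt0 w.
rewrite divr_gt0 ?exprn_gt0// mulr_gt0// ltr_wpDl ?exprn_gt0//.
  by rewrite addr_ge0 ?sqr_ge0.
by rewrite addr_ge0 ?sqr_ge0.
Qed.

Lemma julia_prod_gt0 p q s w : 0 < julia_prod p q s w.
Proof. by apply: mulr_gt0; first apply: mulr_gt0; exact: julia_factor_gt0. Qed.

Lemma bdist_conj w a :
  bdist w (val a) + bdist w (val a)^* = ln (julia_factor w a).
Proof.
have := height_gt0 w; rewrite /bdist /julia_factor /re3 /im3 /height /re2 /im2.
case: (val w) (val a) => [[u v] t] [x y] /= t0.
rewrite !sqr_sqrtr ?addr_ge0 ?sqr_ge0// opprK -lnM ?posrE.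
- by congr ln; field; rewrite gt_eqF.
- by rewrite divr_gt0// ltr_wpDl ?exprn_gt0// addr_ge0 ?sqr_ge0.
- by rewrite divr_gt0// ltr_wpDl ?exprn_gt0// addr_ge0 ?sqr_ge0.
Qed.

Lemma julia_sumE N (F : binary_form R N) p q s w :
  are_upper_roots F [:: p; q; s] ->
  \sum_(b <- complex_roots F) bdist w b = ln (julia_prod p q s w).
Proof.
move=> /complex_rootsP/(perm_big _) ->.
rewrite /with_conjugates big_flatten /= !big_cons !big_nil !addr0 !bdist_conj.
have pos a : julia_factor w a \is Num.pos by rewrite posrE julia_factor_gt0.
rewrite addrA -!lnM //.
by rewrite posrE; apply: mulr_gt0; exact: julia_factor_gt0.
Qed.

Lemma julia_prod_H2 p q s Q : julia_prod p q s (H2_to_H3 Q) =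
  (8 * im2 p * im2 q * im2 s * cosh_prod p q s Q) ^+ 2.
Proof.
have factor a : julia_factor (H2_to_H3 Q) a = (2 * im2 a * mink0 Q a) ^+ 2.
  rewrite /julia_factor /mink0 /re3 /im3 /height /= -/(im2 _); field.
  by rewrite !gt_eqF ?im2_gt0.
by rewrite /julia_prod !factor /cosh_prod; ring.
Qed.

Lemma proj_height_gt0 w : 0 < Num.sqrt (im3 w ^+ 2 + height w ^+ 2).
Proof. by rewrite sqrtr_gt0 ltr_wpDl ?sqr_ge0// exprn_gt0// height_gt0. Qed.

(** The orthogonal projection onto the totally geodesic plane [H2], along the
    circles that are centered on the real axis. *)
Definition proj w : H2 R := H2_point (re3 w) (proj_height_gt0 w).

(** As the right-hand side is nonnegative, projecting onto [H2] decreases each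
    factor, strictly unless [w] is in [H2] or [a] is its projection. *)
Lemma julia_factor_proj w a :
  julia_factor w a - julia_factor (H2_to_H3 (proj w)) a =
  ((re2 (proj w) - re2 a) ^+ 2 + (im2 (proj w) - im2 a) ^+ 2) *
  ((re2 (proj w) - re2 a) ^+ 2 + (im2 (proj w) + im2 a) ^+ 2) *
  (im3 w / (height w * im2 (proj w))) ^+ 2.
Proof.
have t0 := height_gt0 w; have y0 := im2_gt0 (proj w).
have y2 : im2 (proj w) ^+ 2 = im3 w ^+ 2 + height w ^+ 2.
  by rewrite sqr_sqrtr// addr_ge0 ?sqr_ge0.
have eh : height (H2_to_H3 (proj w)) = im2 (proj w) by [].
have ei : im3 (H2_to_H3 (proj w)) = 0 by [].
have er : re3 (H2_to_H3 (proj w)) = re3 w by [].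
have er2 : re2 (proj w) = re3 w by [].
rewrite /julia_factor eh ei er er2.
move: t0 y0 y2 {eh ei er er2}; move: (height w) (im2 (proj w)) (im3 w) (re3 w).
move=> t y v u t0 y0 y2.
have v2 : v ^+ 2 = y ^+ 2 - t ^+ 2 by rewrite y2; ring.
rewrite expr_div_n v2.
transitivity ((((u - re2 a) ^+ 2 + (v ^+ 2 + t ^+ 2) + im2 a ^+ 2) ^+ 2
   - 4 * v ^+ 2 * im2 a ^+ 2) / t ^+ 2
   - ((u - re2 a) ^+ 2 + y ^+ 2 + im2 a ^+ 2) ^+ 2 / y ^+ 2).
  by congr (_ - _); field; rewrite gt_eqF.
by rewrite v2; field; rewrite !gt_eqF.
Qed.

Lemma julia_factor_proj_le w a :
  julia_factor (H2_to_H3 (proj w)) a <= julia_factor w a.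
Proof.
rewrite -subr_ge0 julia_factor_proj mulr_ge0 ?sqr_ge0// mulr_ge0//.
  by rewrite addr_ge0 ?sqr_ge0.
by rewrite addr_ge0 ?sqr_ge0.
Qed.

Lemma julia_factor_proj_lt w a : im3 w != 0 -> a <> proj w ->
  julia_factor (H2_to_H3 (proj w)) a < julia_factor w a.
Proof.
move=> v0 aw; have y0 := im2_gt0 (proj w).
rewrite -subr_gt0 julia_factor_proj mulr_gt0//; last first.
  rewrite exprn_even_gt0 //= mulf_neq0// invr_eq0.
  by rewrite mulf_neq0 ?gt_eqF ?height_gt0.
rewrite mulr_gt0//; last first.
  by rewrite ltr_wpDl ?sqr_ge0// exprn_gt0// addr_gt0 ?im2_gt0.
rewrite lt_def addr_ge0 ?sqr_ge0// andbT paddr_eq0 ?sqr_ge0// !sqrf_eq0.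
rewrite !subr_eq0.
by apply/negP => /andP[/eqP e1 /eqP e2]; apply: aw; apply: H2_eq.
Qed.

Lemma julia_prod_proj_le p q s w :
  julia_prod p q s (H2_to_H3 (proj w)) <= julia_prod p q s w.
Proof.
have ge0 a w' : 0 <= julia_factor w' a := ltW (julia_factor_gt0 w' a).
have le a := julia_factor_proj_le w a.
by apply: ler_pM => //; [exact: mulr_ge0|exact: ler_pM].
Qed.

Lemma ltr_pM3 (a b d A B D : R) : 0 < a -> 0 < b -> 0 < d ->
  a <= A -> b <= B -> d <= D -> a < A \/ b < B \/ d < D ->
  a * b * d < A * B * D.
Proof.
move=> a0 b0 d0 aA bB dD lts; have ab := mulr_gt0 a0 b0.
have abAB : a * b <= A * B by rewrite ler_pM// ltW.
have AB0 := lt_le_trans ab abAB; have D0 := lt_le_trans d0 dD.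
case: lts => [ltA|[ltB|ltD]].
- apply: (@lt_le_trans _ _ (A * B * d)); last by rewrite ler_pM2l.
  rewrite ltr_pM2r//; apply: (@lt_le_trans _ _ (A * b)).
    by rewrite ltr_pM2r.
  by rewrite ler_pM2l// (lt_trans a0).
- apply: (@lt_le_trans _ _ (A * B * d)); last by rewrite ler_pM2l.
  rewrite ltr_pM2r//; apply: (@lt_le_trans _ _ (a * B)).
    by rewrite ltr_pM2l.
  by rewrite ler_pM2r// (lt_trans b0).
- apply: (@le_lt_trans _ _ (A * B * d)); first by rewrite ler_pM2r.
  by rewrite ltr_pM2l.
Qed.

Lemma julia_prod_proj_lt p q s w : im3 w != 0 -> ~ (p = q /\ q = s) ->
  julia_prod p q s (H2_to_H3 (proj w)) < julia_prod p q s w.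
Proof.
move=> v0 neq; have gt0 a w' := julia_factor_gt0 w' a.
have le a := julia_factor_proj_le w a.
have lt a := @julia_factor_proj_lt w a v0.
apply: ltr_pM3 => //.
have [ep|np] := pselect (p = proj w); last by left; exact: lt.
have [eq|nq] := pselect (q = proj w); last by right; left; exact: lt.
right; right; apply: lt => es; apply: neq; split; congruence.
Qed.

Lemma im3_eq0 w : im3 w = 0 -> w = H2_to_H3 (proj w).
Proof.
move=> v0; apply: H3_eq => //.
have -> : height (H2_to_H3 (proj w)) =
  Num.sqrt (im3 w ^+ 2 + height w ^+ 2) by [].
by rewrite v0 expr0n /= add0r sqrtr_sqr gtr0_norm// height_gt0.
Qed.

(** By projection the minimization takes place in [H2], where [julia_prod] is
    an increasing function of [cosh_prod]. *)
Lemma julia_prod_min p q s Q w : klein_balanced Q p q s -> ~ (p = q /\ q = s) ->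
  julia_prod p q s (H2_to_H3 Q) <= julia_prod p q s w /\
  (julia_prod p q s w <= julia_prod p q s (H2_to_H3 Q) -> w = H2_to_H3 Q).
Proof.
move=> kb neq.
pose K := 8 * im2 p * im2 q * im2 s.
have K0 : 0 < K by rewrite !mulr_gt0 ?im2_gt0.
have KP0 Q' : K * cosh_prod p q s Q' \is Num.nneg.
  by rewrite nnegrE; apply/ltW/mulr_gt0/cosh_prod_gt0.
have mono Q1 Q2 :
    (julia_prod p q s (H2_to_H3 Q1) <= julia_prod p q s (H2_to_H3 Q2)) =
    (cosh_prod p q s Q1 <= cosh_prod p q s Q2).
  by rewrite !julia_prod_H2 -/K ler_pXn2r// ler_pM2l.
have [QM Quniq] := cosh_prod_min (proj w) kb.
split; first by apply: le_trans (julia_prod_proj_le p q s w); rewrite mono.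
move=> le; have wQ : proj w = Q.
  by apply: Quniq; rewrite -mono (le_trans (julia_prod_proj_le p q s w)).
have [v0|vn] := eqVneq (im3 w) 0; first by rewrite -wQ; apply: im3_eq0.
have := julia_prod_proj_lt vn neq; rewrite wQ => lt.
by have := lt_le_trans lt le; rewrite ltxx.
Qed.

Lemma argminE (T : choiceType) (x0 x : T) (f : T -> R) :
  (forall z, f x <= f z /\ (f z <= f x -> z = x)) -> argmin x0 f = x.
Proof.
move=> mn; apply: xget_unique => [z|z zmin]; first by case: (mn z).
by have [_] := mn z; apply; apply: zmin.
Qed.

Lemma hyperbolic_zero_balanced N (F : binary_form R N) p q s :
  are_upper_roots F [:: p; q; s] -> balanced (hyperbolic_zero F) p q s.
Proof.
move=> roots; have [Q bal] := balanced_exists p q s.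
suff -> : hyperbolic_zero F = Q by [].
apply: argminE => Q'.
have sumE Q1 : \sum_(a <- upper_roots F) cosh (hdist Q1 a) = cosh_sum p q s Q1.
  rewrite (perm_big _ (upper_rootsP roots)) !big_cons big_nil !cosh_hdistE.
  by rewrite /= addr0 addrA.
by rewrite !sumE; exact: cosh_sum_min bal.
Qed.

(** Three of the six roots coincide only if they are the three upper roots or
    their three conjugates. *)
Lemma stableE (F : binary_form R 6) p q s :
  are_upper_roots F [:: p; q; s] -> stable F <-> ~ (p = q /\ q = s).
Proof.
move=> /complex_rootsP perm.
have cnt b : count_mem b (complex_roots F) =
    count_mem b (with_conjugates [:: p; q; s]) by move/seq.permP: perm => ->.
split=> [st [pq qs]|neq b].
  have := st (val p); rewrite cnt -qs -pq /with_conjugates /= !eqxx.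
  by case: (_ == _).
rewrite cnt; apply: contra_notT neq; rewrite -leqNgt /with_conjugates /=.
have up (a : H2 R) : 0 < complex.Im (sval a) := im2_gt0 a.
have dn (a : H2 R) : complex.Im (sval a)^* < 0.
  by have := up a; case: (sval a) => u v /=; rewrite oppr_lt0.
have [b0|b0] := ltP 0 (complex.Im b).
  have nb (a : H2 R) : ((sval a)^* == b) = false.
    by apply/eqP => e; have := dn a; rewrite e ltNge (ltW b0).
  rewrite !nb; case: eqP => [ep|_]; case: eqP => [eq|_]; case: eqP => [es|_] //.
  by move=> _; split; apply: val_inj; rewrite /= ?ep ?eq ?es.
have nb (a : H2 R) : (sval a == b) = false.
  by apply/eqP => e; have := up a; rewrite e ltNge b0.
rewrite !nb; case: eqP => [ep|_]; case: eqP => [eq|_]; case: eqP => [es|_] //.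
have cinj : injective (fun z : R[i] => z^*) by apply: can_inj (@conjcK R).
by move=> _; split; apply: val_inj; apply: cinj; rewrite /= ?ep ?eq ?es.
Qed.

(** A minimizer of [cosh_prod] exists, so [julia_zero F] is never the junk value
    of [argmin]; this is what the direct implication needs. *)
Lemma julia_zero_stable (F : binary_form R 6) p q s Q :
  are_upper_roots F [:: p; q; s] -> ~ (p = q /\ q = s) ->
  julia_zero F = H2_to_H3 Q <-> klein_balanced Q p q s.
Proof.
move=> roots neq.
have main Q' : klein_balanced Q' p q s -> julia_zero F = H2_to_H3 Q'.
  move=> kb; rewrite /julia_zero asboolT; last exact/(stableE roots).
  apply: argminE => w; rewrite !(julia_sumE _ roots).
  by rewrite !ler_ln ?posrE ?julia_prod_gt0//; apply: julia_prod_min.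
split=> [|/main//].
have [Q0 /min_klein_balanced kb] := cosh_prod_min_exists p q s.
by rewrite (main _ kb) => /H2_to_H3_inj <-.
Qed.

End JuliaAndHyperbolicZeros.

Theorem proposition12 (R : realType) (F : binary_form R 6)
    (alpha1 alpha2 alpha3 : H2 R)
    (F_no_real_root : no_real_root F)
    (F_roots : are_upper_roots F [:: alpha1; alpha2; alpha3]) :
  julia_zero F = H2_to_H3 (hyperbolic_zero F) <->
  (~ collinear alpha1 alpha2 alpha3 /\ equilateral alpha1 alpha2 alpha3) \/
  (collinear alpha1 alpha2 alpha3 /\
   (is_midpoint alpha1 alpha2 alpha3 \/
    is_midpoint alpha2 alpha1 alpha3 \/
    is_midpoint alpha3 alpha1 alpha2)).
Proof.
have bal := hyperbolic_zero_balanced F_roots.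
set Q := hyperbolic_zero F in bal *.
have [[e12 e23]|neq] := pselect (alpha1 = alpha2 /\ alpha2 = alpha3).
  have self : balanced alpha1 alpha1 alpha1 alpha1.
    by rewrite /balanced mink1_self mink2_self !addr0.
  have Qa : Q = alpha1.
    move: bal; rewrite -e23 -e12 => bal.
    have [Qmin _] := cosh_sum_min alpha1 bal.
    by have [_] := cosh_sum_min Q self; apply.
  have roots1 : upper_roots F = [:: alpha1; alpha1; alpha1].
    have /all_pred1P : all (pred1 alpha1) (upper_roots F).
      by rewrite (perm_all _ (upper_rootsP F_roots)) -e23 -e12 /= eqxx.
    by rewrite (perm_size (upper_rootsP F_roots)).
  split=> _.
    right; split; last first.
      left; rewrite -e23 -e12; exact: center_midpoint.
    exists [set a | re2 a = re2 alpha1]; rewrite -e23 -e12; split=> //.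
    by left; exists (re2 alpha1).
  rewrite /julia_zero asboolF; last by move/(stableE F_roots); apply.
  by rewrite roots1 /= Qa.
rewrite (julia_zero_stable _ F_roots neq); split=> [kb|].
  have [col|ncol] := pselect (collinear alpha1 alpha2 alpha3).
    right; split=> //; apply: (dependent_midpoint bal kb).
    exact: collinear_dependent.
  left; split=> //; apply: (independent_equilateral bal kb).
  by move/dependent_collinear.
case=> [[_ eql]|[_ mid]]; first exact: equilateral_balanced.
have swap p q s : balanced Q p q s -> balanced Q p s q.
  by case=> e1 e2; split; rewrite addrAC.
have kswap p q s : klein_balanced Q p q s -> klein_balanced Q p s q.
  by case=> e1 e2; split; rewrite addrAC.
case: mid => [m1|[m2|m3]].
- exact: midpoint_balanced.
- apply/klein_balanced_rot/klein_balanced_rot/kswap/midpoint_balanced => //.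
  exact/swap/balanced_rot.
- apply/klein_balanced_rot/midpoint_balanced => //.
  exact/balanced_rot/balanced_rot.
Qed.
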